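(* Consider the following game over slots $1,\dots,T$ with $N\ge2$ users and an integer $1\le k<N$. The BS chooses a probability distribution on $k$-element subsets of the users. In every slot it independently schedules a random $k$-subset drawn from this distribution. The adversary chooses a blocking matrix $\sigma\in\{0,1\}^{N\times T}$, where $\sigma_i(t)=0$ means user $i$ is blocked in slot $t$. Feasibility means $\sum_{i,t}(1-\sigma_i(t))\le\alpha T$ and $\sum_i(1-\sigma_i(t))\le k_a$ for each $t$, where $k_a\ge1$ and $0<\alpha<1$. Ages satisfy $a_i(1)=1$, $a_i(t+1)=1$ if user $i$ is scheduled and not blocked in slot $t$, and $a_i(t+1)=a_i(t)+1$ otherwise. The payoff is the average age $\frac1T\sum_{t=1}^T\frac1N\sum_i\mathbb E[a_i(t)]$; the BS minimizes it and the adversary maximizes it. Then, for all sufficiently large $T$ with $\alpha T\in\mathbb Z$, this game has no Nash equilibrium. Here the BS's strategies are the distributions on $k$-subsets, and the adversary's strategies are the feasible blocking matrices. *)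

(* Defs.v *)
From HB Require Import structures.
From mathcomp Require Import all_boot all_order all_algebra.
From mathcomp Require Import reals.
Set Implicit Arguments. Unset Strict Implicit. Unset Printing Implicit Defensive.
Import Order.TTheory GRing.Theory Num.Theory.
Local Open Scope ring_scope.

(* Slots are 0-indexed: ordinal s : 'I_T is slot s+1 of the paper. *)

Definition is_kdist (R : realType) (N k : nat) (p : {ffun {set 'I_N} -> R}) : Prop :=
  [/\ forall S : {set 'I_N}, 0 <= p S, forall S : {set 'I_N}, #|S| != k -> p S = 0 & \sum_(S : {set 'I_N}) p S = 1].

Definition feasible (R : realType) (N T ka : nat) (alpha : R)
    (sigma : 'M[bool]_(N, T)) : Prop :=
  ((#|[set x : 'I_N * 'I_T | ~~ sigma x.1 x.2]|)%:R <= alpha * T%:R) /\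
  (forall t : 'I_T, (#|[set i : 'I_N | ~~ sigma i t]| <= ka)%N).

Definition success (N T : nat) (sigma : 'M[bool]_(N, T))
    (omega : {ffun 'I_T -> {set 'I_N}}) (i : 'I_N) (s : 'I_T) : bool :=
  (i \in omega s) && sigma i s.

(* age sigma omega i t = a_i(t+1) of the paper *)
Fixpoint age (N T : nat) (sigma : 'M[bool]_(N, T))
    (omega : {ffun 'I_T -> {set 'I_N}}) (i : 'I_N) (t : nat) : nat :=
  match t with
  | 0 => 1
  | t'.+1 =>
      if (if insub t' is Some s then success sigma omega i s else false)
      then 1 else (age sigma omega i t').+1
  end.

(* E[a_i(t+1)] when slots are scheduled i.i.d. according to p. *)
Definition expected_age (R : realType) (N T : nat) (p : {ffun {set 'I_N} -> R})
    (sigma : 'M[bool]_(N, T)) (i : 'I_N) (t : nat) : R :=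
  \sum_(omega : {ffun 'I_T -> {set 'I_N}})
     (\prod_(s : 'I_T) p (omega s)) * (age sigma omega i t)%:R.

Definition payoff (R : realType) (N T : nat) (p : {ffun {set 'I_N} -> R})
    (sigma : 'M[bool]_(N, T)) : R :=
  T%:R^-1 * \sum_(t < T) (N%:R^-1 * \sum_(i < N) expected_age p sigma i t).

Definition is_nash (R : realType) (N T k ka : nat) (alpha : R)
    (p : {ffun {set 'I_N} -> R}) (sigma : 'M[bool]_(N, T)) : Prop :=
  [/\ is_kdist k p, feasible ka alpha sigma,
      (forall p', is_kdist k p' -> payoff p sigma <= payoff p' sigma) &
      (forall sigma' : 'M[bool]_(N, T), feasible ka alpha sigma' -> payoff p sigma' <= payoff p sigma)].

(* Main.v *)
Require Import Defs.
From HB Require Import structures.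
From mathcomp Require Import all_boot all_order all_algebra.
From mathcomp Require Import reals.
From mathcomp Require Import ring lra.
Import Order.TTheory GRing.Theory Num.Theory.
Local Open Scope ring_scope.

(** The expected age of a user scheduled with probability [q] per slot obeys
    [A(t+1) = 1 + (1 - q s(t)) A(t)], so it only depends on the marginal of the
    strategy. Summing the recursion gives the exact identity
    [sum_(t<T) A(t) = (T + 1 - A(T)) / q + sum_(t blocked) A(t)], whence a user
    with [b] blocked slots has total age at most [T/q + b/q + b(b-1)/2], with
    near equality for one contiguous window far from both ends.
    Suppose there is an equilibrium of value [v], and let [m = alpha T].
    Averaging over the user that receives a window of [m] blocks, convexity of
    [A] in [q] bounds [v] below by what the window yields against uniform
    scheduling. On the other hand, if the equilibrium blocking matrix does not
    spend all [m] blocks on one user, uniform scheduling already does better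
    for the base station by about [m/2]; if it does, then shifting a fixed small
    weight towards that user costs the others only to second order and gains an
    amount linear in [T]. Both contradict the lower bound for large [T]. *)

(** * Mean age of one user under a fixed blocking pattern *)

Section MeanAge.
Variable R : realType.
Implicit Types (q y : R) (r : nat -> bool) (t T : nat).

(** Here [q] is the chance of being scheduled in a slot and [r s] is true when slot [s] is not
    blocked. The age resets with probability [q * r t'], independently of its current value. *)
Fixpoint mean_age q r t : R :=
  if t is t'.+1 then 1 + (1 - q * (r t')%:R) * mean_age q r t' else 1.

Definition blocks r T : nat := (\sum_(t < T) ~~ r t)%N.

Definition total_age q r T : R := \sum_(t < T) mean_age q r t.

Lemma eq_mean_age q r r' t :
  (forall s, (s < t)%N -> r s = r' s) -> mean_age q r t = mean_age q r' t.
Proof.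
elim: t => //= t IHt eq_r; rewrite eq_r // IHt // => s s_t.
by rewrite eq_r // ltnW.
Qed.

Lemma eq_total_age q r r' T :
  (forall s, (s < T)%N -> r s = r' s) -> total_age q r T = total_age q r' T.
Proof.
move=> eq_r; apply: eq_bigr => t _; apply: eq_mean_age => s s_t.
by rewrite eq_r // (ltn_trans s_t).
Qed.

Lemma mean_age_ge1 q r t : 0 <= q -> q <= 1 -> 1 <= mean_age q r t.
Proof.
move=> q_ge0 q_le1; elim: t => //= t IHt.
by rewrite lerDl mulr_ge0 //; [case: (r t); rewrite /=; lra | lra].
Qed.

(** With A for the mean age, [1 + A(t) - A(t+1)] equals [q A(t)] in an unblocked slot and 0 in a
    blocked one. Dividing by [q] and telescoping gives all terms except those of the blocked slots,
    which the second sum supplies. *)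
Lemma total_ageE q r T : q != 0 ->
  total_age q r T =
    (T%:R + 1 - mean_age q r T) / q + \sum_(t < T) (~~ r t)%:R * mean_age q r t.
Proof.
move=> q_neq0; rewrite /total_age; elim: T => [|T IHT].
  by rewrite !big_ord0 /= add0r subrr mul0r addr0.
rewrite !big_ord_recr /= IHT -natr1; case: (r T) => /=; by field.
Qed.

(** Unblocked slots contract the age towards the fixed point [q^-1], and each blocked slot adds
    1. *)
Lemma mean_age_le q r t : 0 < q -> q <= 1 ->
  mean_age q r t <= q^-1 + (blocks r t)%:R.
Proof.
move=> q_gt0 q_le1; rewrite /blocks; elim: t => [|t IHt].
  by rewrite big_ord0 addr0 invf_ge1.
rewrite big_ord_recr natrD /=; case: (r t) => /=; last by lra.
set b := _%:R in IHt *; have b_ge0 : 0 <= b by exact: ler0n.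
have le1 : (1 - q) * mean_age q r t <= (1 - q) * (q^-1 + b).
  by rewrite ler_wpM2l // subr_ge0.
have : (1 - q) * (q^-1 + b) = q^-1 - 1 + b - q * b by field; lra.
have : 0 <= q * b by rewrite mulr_ge0 // ltW.
lra.
Qed.

(** The blocked slot preceded by j others sees a mean age of at most [q^-1 + j]. *)
Lemma blocked_age_le q r T : 0 < q -> q <= 1 ->
  \sum_(t < T) (~~ r t)%:R * mean_age q r t <=
    (blocks r T)%:R / q + (blocks r T)%:R * ((blocks r T)%:R - 1) / 2.
Proof.
move=> q_gt0 q_le1; rewrite /blocks; elim: T => [|T IHT].
  by rewrite !big_ord0 mul0r add0r mul0r mul0r.
have := mean_age_le q r T q_gt0 q_le1.
rewrite /blocks !big_ord_recr natrD /=; set b := _%:R in IHT *; case: (r T) => /= le_b.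
  by rewrite mul0r !addr0.
by rewrite mulrDl !mul1r; lra.
Qed.

Lemma total_age_le q r T : 0 < q -> q <= 1 ->
  total_age q r T <=
    T%:R / q + (blocks r T)%:R / q + (blocks r T)%:R * ((blocks r T)%:R - 1) / 2.
Proof.
move=> q_gt0 q_le1; rewrite total_ageE ?gt_eqF //.
have := blocked_age_le q r T q_gt0 q_le1.
have : (T%:R + 1 - mean_age q r T) / q <= T%:R / q.
  rewrite ler_pM2r ?invr_gt0 //.
  by have := mean_age_ge1 q r T (ltW q_gt0) q_le1; lra.
lra.
Qed.

Lemma total_age_unblocked_ge q T : 0 < q -> q <= 1 ->
  T%:R / q - q^-1 ^+ 2 <= total_age q (fun=> true) T.
Proof.
move=> q_gt0 q_le1; rewrite total_ageE ?gt_eqF // [X in _ <= _ + X]big1 ?addr0 => [|t _].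
  have := mean_age_le q (fun=> true) T q_gt0 q_le1.
  rewrite /blocks big1 // addr0 => le_q.
  rewrite expr2 -mulrBl ler_pM2r ?invr_gt0 //; lra.
by rewrite mul0r.
Qed.

(** * One contiguous window of blocked slots *)

Definition window (c m s : nat) : bool := ~~ (c <= s < c + m)%N.

Lemma mean_age_before q c m : q != 0 ->
  mean_age q (window c m) c = (1 - (1 - q) ^+ c.+1) / q.
Proof.
move=> q_neq0; rewrite (@eq_mean_age _ _ (fun=> true)); last first.
  by move=> s s_c; rewrite /window leqNgt s_c.
elim: c => [|c IHc] /=; first by rewrite expr1; field.
by rewrite IHc [_ ^+ c.+2]exprS; field.
Qed.

Lemma mean_age_during q c m j : (j <= m)%N ->
  mean_age q (window c m) (c + j) = mean_age q (window c m) c + j%:R.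
Proof.
elim: j => [|j IHj] j_m; first by rewrite addn0 addr0.
rewrite addnS /= IHj ?(ltnW j_m) // /window leq_addr ltn_add2l j_m /=.
by rewrite -natr1; ring.
Qed.

Lemma mean_age_after q c m n : q != 0 ->
  mean_age q (window c m) (c + m + n) - q^-1 =
  (1 - q) ^+ n * (mean_age q (window c m) (c + m) - q^-1).
Proof.
move=> q_neq0; elim: n => [|n IHn]; first by rewrite addn0 expr0 mul1r.
rewrite addnS /= exprS -mulrA -IHn {1}/window [(_ < c + m)%N]ltnNge leq_addr andbF /=.
by field.
Qed.

Lemma sum_window (F : nat -> R) c m n :
  \sum_(t < c + m + n) (~~ window c m t)%:R * F t = \sum_(j < m) F (c + j)%N.
Proof.
rewrite -(big_mkord xpredT (fun t => (~~ window c m t)%:R * F t)).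
rewrite (@big_cat_nat _ _ _ (c + m)) ?leq_addr //=.
rewrite (@big_cat_nat _ _ _ c) ?leq_addr //=.
rewrite big_nat big1 ?add0r => [|t /andP[_ t_c]]; last first.
  by rewrite /window leqNgt t_c mul0r.
rewrite [X in _ + X]big_nat [X in _ + X]big1 ?addr0 => [|t /andP[t_ge _]]; last first.
  by rewrite /window [(t < _)%N]ltnNge t_ge andbF mul0r.
rewrite -{1}[c]add0n big_addn addKn big_mkord; apply: eq_bigr => j _.
by rewrite addnC /window leq_addr ltn_add2l ltn_ord mul1r.
Qed.

Lemma blocks_window c m n : blocks (window c m) (c + m + n) = m.
Proof.
apply/eqP; rewrite -(@eqr_nat R) natr_sum; apply/eqP.
have := sum_window (fun=> 1) c m n; rewrite sumr_const card_ord => <-.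
by apply: eq_bigr => t _; rewrite mulr1.
Qed.

Lemma blocked_age_window q c m n :
  \sum_(t < c + m + n) (~~ window c m t)%:R * mean_age q (window c m) t =
  m%:R * mean_age q (window c m) c + m%:R * (m%:R - 1) / 2.
Proof.
rewrite sum_window.
rewrite (eq_bigr (fun j : 'I_m => mean_age q (window c m) c + j%:R)) => [|j _]; last first.
  by rewrite mean_age_during // ltnW.
rewrite big_split /= sumr_const card_ord mulr_natl; congr (_ + _).
elim: m => [|j IHj]; first by rewrite big_ord0 !mul0r.
by rewrite big_ord_recr /= IHj -natr1; field.
Qed.

(** A window attains the upper bound [total_age_le] up to a constant and two errors
    [m (1 - q)^c / q]. One arises because the age is not yet [q^-1] when the window opens, the other
    from the excess age that survives the [n >= c] slots after it. *)
Lemma total_age_window_ge q c m n : 0 < q -> q <= 1 -> (c <= n)%N ->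
  (c + m + n)%:R / q - q^-1 ^+ 2 + m%:R / q + m%:R * (m%:R - 1) / 2
    - 2 * (m%:R * (1 - q) ^+ c / q) <= total_age q (window c m) (c + m + n).
Proof.
move=> q_gt0 q_le1 c_n; have q_neq0 : q != 0 by rewrite gt_eqF.
have rho_ge0 : 0 <= 1 - q by rewrite subr_ge0.
have rho_le1 : 1 - q <= 1 by lra.
have q1_gt0 : 0 < q^-1 by rewrite invr_gt0.
have m_ge0 : 0 <= m%:R :> R by exact: ler0n.
rewrite total_ageE // blocked_age_window.
have before := mean_age_before q c m q_neq0.
have pow_c : (1 - q) ^+ c.+1 <= (1 - q) ^+ c by exact: ler_wiXn2l.
have pow_c0 : 0 <= (1 - q) ^+ c.+1 by exact: exprn_ge0.
have pow_n : (1 - q) ^+ n <= (1 - q) ^+ c by exact: ler_wiXn2l.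
have pow_n0 : 0 <= (1 - q) ^+ n by exact: exprn_ge0.
have le_before : mean_age q (window c m) c <= q^-1.
  by rewrite before -[leRHS]mul1r ler_pM2r //; lra.
have ge_before : m%:R / q - m%:R * (1 - q) ^+ c / q <= m%:R * mean_age q (window c m) c.
  rewrite before mulrA -mulrBl ler_pM2r // -[X in X - _]mulr1 -mulrBr.
  by rewrite ler_wpM2l //; lra.
have le_end : mean_age q (window c m) (c + m + n) - q^-1 <= m%:R * (1 - q) ^+ c.
  rewrite mean_age_after // mean_age_during // [leRHS]mulrC.
  apply: le_trans (_ : (1 - q) ^+ n * m%:R <= _); last by rewrite ler_wpM2r.
  by rewrite ler_wpM2l //; lra.
have : (c + m + n)%:R / q - q^-1 ^+ 2 - m%:R * (1 - q) ^+ c / q <=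
    ((c + m + n)%:R + 1 - mean_age q (window c m) (c + m + n)) / q.
  rewrite expr2 -!mulrBl ler_pM2r //; lra.
lra.
Qed.

(** * Convexity in the scheduling probability *)

(** A supporting line at [q] of slope [-B]. In an unblocked slot the recursion leaves the surplus
    [B (y - q)^2], so the induction has to carry [0 <= B]. *)
Lemma mean_age_tangent q r t : 0 <= q -> q <= 1 ->
  exists2 B : R, 0 <= B &
    forall y, y <= 1 -> mean_age q r t - B * (y - q) <= mean_age y r t.
Proof.
move=> q_ge0 q_le1; elim: t => [|t [B B_ge0 IHt]] /=.
  by exists 0 => // y _; rewrite mul0r subr0.
case: (r t) => /=; last by exists B => // y /IHt; lra.
have A_ge1 := mean_age_ge1 q r t q_ge0 q_le1.
exists (mean_age q r t + (1 - q) * B) => [|y y_le1].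
  by rewrite addr_ge0 ?mulr_ge0 //; lra.
have : (1 - y) * (mean_age q r t - B * (y - q)) <= (1 - y) * mean_age y r t.
  by rewrite ler_wpM2l ?IHt // subr_ge0.
have : 0 <= B * (y - q) ^+ 2 by rewrite mulr_ge0 // sqr_ge0.
rewrite !mulr1; set A := mean_age q r t; set A' := mean_age y r t.
lra.
Qed.

(** The deviations [x i - q] sum to zero, so the linear terms of the supporting lines at [q]
    cancel. *)
Lemma jensen_total_age (I : finType) (x : I -> R) q r T :
  0 <= q -> q <= 1 -> (forall i, x i <= 1) -> \sum_i x i = #|I|%:R * q ->
  #|I|%:R * total_age q r T <= \sum_i total_age (x i) r T.
Proof.
move=> q_ge0 q_le1 x_le1 sum_x.
rewrite /total_age exchange_big /= mulr_sumr; apply: ler_sum => t _.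
have [B _ tangent] := mean_age_tangent q r t q_ge0 q_le1.
have -> : #|I|%:R * mean_age q r t = \sum_i (mean_age q r t - B * (x i - q)).
  rewrite sumrB -mulr_sumr sumrB sum_x !sumr_const !mulr_natl subrr mulr0.
  by rewrite subr0.
by apply: ler_sum => i _; exact: tangent.
Qed.

End MeanAge.

(** * Random schedules and their marginals *)

Section Scheduling.
Variables (R : realType) (N : nat).
Implicit Types (p : {ffun {set 'I_N} -> R}) (i : 'I_N).

Definition marginal p i : R := \sum_(S : {set 'I_N} | i \in S) p S.

(** Slots beyond the horizon count as blocked, just as [age] has no success there. *)
Definition row_of {T} (sigma : 'M[bool]_(N, T)) i (t : nat) : bool :=
  if insub t is Some s then sigma i s else false.

Lemma row_ofE {T} (sigma : 'M[bool]_(N, T)) i (s : 'I_T) :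
  row_of sigma i s = sigma i s.
Proof. by rewrite /row_of valK. Qed.

Lemma sum_marginal k p : is_kdist k p -> \sum_i marginal p i = k%:R.
Proof.
case=> _ p_card p_sum; rewrite /marginal.
under eq_bigr do rewrite big_mkcond /=.
rewrite exchange_big /=.
have -> : k%:R = (\sum_S p S) * k%:R by rewrite p_sum mul1r.
rewrite mulr_suml; apply: eq_bigr => S _.
have [cardS|/p_card ->] := eqVneq #|S| k.
  by rewrite -big_mkcond sumr_const cardS mulr_natr.
by rewrite mul0r big1 // => i _; rewrite if_same.
Qed.

Lemma marginal_le1 k p i : is_kdist k p -> marginal p i <= 1.
Proof.
case=> p_ge0 _ <-; rewrite /marginal [leRHS](bigID (fun S : {set 'I_N} => i \in S)) /=.
by rewrite lerDl sumr_ge0.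
Qed.

(* The weight [phi] keeps track of the slots after [t], which are independent
   of [age sigma omega i t]. *)
Lemma expected_age_weighted k p T (sigma : 'M[bool]_(N, T)) i t
    (phi : 'I_T -> {set 'I_N} -> R) :
  is_kdist k p -> (t <= T)%N -> (forall (s : 'I_T) S, (s < t)%N -> phi s S = 1) ->
  \sum_(omega : {ffun 'I_T -> {set 'I_N}})
    (\prod_s (p (omega s) * phi s (omega s))) * (age sigma omega i t)%:R =
  mean_age R (marginal p i) (row_of sigma i) t *
    \prod_s \sum_S (p S * phi s S).
Proof.
move=> pK; have [_ _ p_sum] := pK; elim: t phi => [|t IHt] phi t_T phi1.
  by rewrite /= mul1r bigA_distr_bigA; apply: eq_bigr => omega _; rewrite mulr1.
pose s0 := Ordinal t_T.
(* The age after slot [t] is 1 plus [fail] times the age before it; [fail] is absorbed into the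
   weight of slot [t], and the induction hypothesis is applied to [phi']. *)
pose fail (S : {set 'I_N}) : R := (~~ ((i \in S) && sigma i s0))%:R.
pose phi' s S := phi s S * (if s == s0 then fail S else 1).
have phi'1 (s : 'I_T) S : (s < t)%N -> phi' s S = 1.
  by move=> s_t; rewrite /phi' phi1 ?ltnS 1?ltnW // -val_eqE /= ltn_eqF // mulr1.
have mean_fail : \sum_S p S * fail S = 1 - marginal p i * (row_of sigma i t)%:R.
  rewrite (row_ofE sigma i s0) -[X in _ = X - _]p_sum /marginal.
  rewrite (big_mkcond (fun S : {set 'I_N} => i \in S)) /= mulr_suml -sumrB.
  apply: eq_bigr => S _; rewrite /fail.
  by case: (i \in S); case: (sigma i s0) => /=; ring.
have prod_phi' : \prod_s (\sum_S p S * phi' s S) =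
    (\sum_S p S * fail S) * \prod_s (\sum_S p S * phi s S).
  rewrite (bigD1 s0) //= [in RHS](bigD1 s0) //=.
  have -> : \sum_S p S * phi s0 S = 1.
    by rewrite -[RHS]p_sum; apply: eq_bigr => S _; rewrite phi1 ?mulr1 //=.
  rewrite mul1r; congr (_ * _).
    by apply: eq_bigr => S _; rewrite /phi' eqxx phi1 // mul1r.
  by apply: eq_bigr => s /negPf s_s0; apply: eq_bigr => S _; rewrite /phi' s_s0 mulr1.
rewrite [mean_age _ _ _ _]/= -mean_fail mulrDl mul1r [(\sum__ _) * _]mulrC.
rewrite -mulrA -prod_phi' -(IHt phi') ?(ltnW t_T) // bigA_distr_bigA -big_split /=.
apply: eq_bigr => omega _.
have -> : \prod_s (p (omega s) * phi' s (omega s)) =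
    (\prod_s (p (omega s) * phi s (omega s))) * fail (omega s0).
  rewrite (bigD1 s0) //= [in RHS](bigD1 s0) //= /phi' eqxx.
  rewrite (eq_bigr (fun s => p (omega s) * phi s (omega s))); last first.
    by move=> s /negPf ->; rewrite mulr1.
  by ring.
rewrite (_ : insub t = Some s0); last exact: (valK s0).
rewrite /success /fail; case: (_ && _) => /=; first by ring.
by rewrite -natr1; ring.
Qed.

Lemma expected_ageE k p T (sigma : 'M[bool]_(N, T)) i t :
  is_kdist k p -> (t <= T)%N ->
  expected_age p sigma i t = mean_age R (marginal p i) (row_of sigma i) t.
Proof.
move=> pK t_T; have [_ _ p_sum] := pK.
have := expected_age_weighted k p T sigma i t (fun _ _ => 1) pK t_T (fun _ _ _ => erefl).
rewrite [\prod_s \sum_S _]big1 => [|s _]; last first.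
  by rewrite -[RHS]p_sum; apply: eq_bigr => S _; rewrite /= mulr1.
rewrite mulr1 => <-; apply: eq_bigr => omega _; congr (_ * _).
by apply: eq_bigr => s _; rewrite /= mulr1.
Qed.

(** The payoff sees a strategy only through its marginals, so all comparisons reduce to sums of
    [total_age]. *)
Lemma payoffE k p T (sigma : 'M[bool]_(N, T)) : is_kdist k p ->
  payoff p sigma =
    (T%:R^-1 * N%:R^-1) * \sum_i total_age R (marginal p i) (row_of sigma i) T.
Proof.
move=> pK; rewrite /payoff -mulr_sumr -mulrA /total_age [in RHS]exchange_big /=.
congr (_ * (_ * _)); apply: eq_bigr => t _; apply: eq_bigr => i _.
by rewrite (expected_ageE k) // ltnW.
Qed.

(** * The uniform strategy and its tilts *)

Definition uniform_kdist k : {ffun {set 'I_N} -> R} :=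
  [ffun S : {set 'I_N} => if #|S| == k then 'C(N, k)%:R^-1 else 0].

Lemma uniform_kdistP k : (k <= N)%N -> is_kdist k (uniform_kdist k).
Proof.
move=> k_N; have C_gt0 : 0 < 'C(N, k)%:R :> R by rewrite ltr0n bin_gt0.
split=> [S|S /negPf cardS|]; rewrite ?ffunE ?cardS //.
  by case: ifP => // _; rewrite invr_ge0 ltW.
under eq_bigr do rewrite ffunE.
rewrite -big_mkcond /= sumr_const -cardsE card_draws card_ord -[LHS]mulr_natl.
by rewrite divff // gt_eqF.
Qed.

(** By complement: the [k]-sets avoiding [i] number C(N-1, k), and
    [N C(N-1, k) = (N - k) C(N, k)]. *)
Lemma marginal_uniform k i : (k <= N)%N ->
  marginal (uniform_kdist k) i = k%:R / N%:R.
Proof.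
move=> k_N; have C_gt0 : 0 < 'C(N, k)%:R :> R by rewrite ltr0n bin_gt0.
have N_gt0 : 0 < N%:R :> R by rewrite ltr0n (leq_ltn_trans _ (ltn_ord i)).
have [_ _] := uniform_kdistP k k_N.
rewrite (bigID (fun S : {set 'I_N} => i \in S)) /= -/(marginal _ i).
have -> : \sum_(S : {set 'I_N} | i \notin S) uniform_kdist k S =
    'C(N.-1, k)%:R / 'C(N, k)%:R.
  under eq_bigr do rewrite ffunE.
  rewrite -big_mkcondr /= sumr_const -[LHS]mulr_natl; congr (_%:R / _).
  have := cards_draws [set~ i] k; rewrite cardsC1 card_ord => <-.
  by apply: eq_card => S; rewrite !inE subsetC sub1set inE.
move=> sum1; have : (N * 'C(N.-1, k) = (N - k) * 'C(N, k))%N.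
  by rewrite -{1 3}(prednK (leq_ltn_trans (leq0n _) (ltn_ord i))) mul_bin_down
     prednK // (leq_ltn_trans _ (ltn_ord i)).
move/(congr1 (fun n => n%:R : R)); rewrite !natrM natrB // => bin_eq.
have -> : marginal (uniform_kdist k) i = 1 - 'C(N.-1, k)%:R / 'C(N, k)%:R.
  by lra.
apply: (mulfI (lt0r_neq0 N_gt0)); rewrite mulrBr mulrA bin_eq.
by field; rewrite !lt0r_neq0.
Qed.

(** The deviation used when all blocks fall on one user: [S0] will contain that user. *)
Definition tilted_kdist k (l : R) (S0 : {set 'I_N}) : {ffun {set 'I_N} -> R} :=
  [ffun S : {set 'I_N} => (1 - l) * uniform_kdist k S + l * (S == S0)%:R].

Lemma tilted_kdistP k (l : R) (S0 : {set 'I_N}) :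
  (k <= N)%N -> 0 <= l -> l <= 1 -> #|S0| = k ->
  is_kdist k (tilted_kdist k l S0).
Proof.
move=> k_N l_ge0 l_le1 cardS0; have [u_ge0 u_card u_sum] := uniform_kdistP k k_N.
split=> [S|S cardS|].
- by rewrite ffunE addr_ge0 ?mulr_ge0 ?subr_ge0.
- rewrite ffunE u_card // mulr0 add0r.
  by have [E|] := eqVneq S S0; [rewrite E cardS0 eqxx in cardS | rewrite mulr0].
under eq_bigr do rewrite ffunE.
rewrite big_split -!mulr_sumr /= u_sum (bigD1 S0) //= eqxx big1 => [|S /negPf -> //].
by rewrite addr0 !mulr1 subrK.
Qed.

Lemma marginal_tilted k (l : R) (S0 : {set 'I_N}) i : (k <= N)%N ->
  marginal (tilted_kdist k l S0) i = (1 - l) * (k%:R / N%:R) + l * (i \in S0)%:R.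
Proof.
move=> k_N; rewrite -(marginal_uniform k i k_N) /marginal.
under eq_bigr do rewrite ffunE.
rewrite big_split -!mulr_sumr /=; congr (_ + _ * _).
have [iS0|iS0] := boolP (i \in S0).
  by rewrite (bigD1 S0) //= eqxx big1 ?addr0 // => S /andP[_ /negPf ->].
by rewrite big1 // => S iS; case: eqP => // E; rewrite -E iS in iS0.
Qed.

Lemma sum_blocks T (sigma : 'M[bool]_(N, T)) :
  (\sum_i blocks (row_of sigma i) T)%N = #|[set x : 'I_N * 'I_T | ~~ sigma x.1 x.2]|.
Proof.
rewrite -sum1dep_card [RHS]big_mkcond /= /blocks pair_bigA /=.
by apply: eq_bigr => -[i t] _ /=; rewrite row_ofE; case: (sigma i t).
Qed.

End Scheduling.

(** A Bernoulli-type estimate [(1 + c q) (1 - q)^c <= 1] reduces this to the Archimedean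
    property. *)
Lemma exists_small_power (R : realType) (q e : R) :
  0 < q -> q <= 1 -> 0 < e -> exists c : nat, (1 - q) ^+ c <= e.
Proof.
move=> q_gt0 q_le1 e_gt0.
have bernoulli c : (1 + c%:R * q) * (1 - q) ^+ c <= 1.
  elim: c => [|c IHc]; first by rewrite expr0; lra.
  apply: le_trans IHc; rewrite exprS mulrA ler_wpM2r ?exprn_ge0 ?subr_ge0 //.
  have : 0 <= (c%:R + 1) * q ^+ 2 by rewrite mulr_ge0 ?sqr_ge0 ?addr_ge0.
  by rewrite -natr1; lra.
have eq_gt0 : 0 < e * q by rewrite mulr_gt0.
exists (Num.bound (e * q)^-1); set c := Num.bound _.
have c_large : 1 < c%:R * (e * q).
  by rewrite -ltr_pdivrMr // mul1r archi_boundP // invr_ge0 ltW.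
have := bernoulli c; rewrite leNgt => /negP not_lt.
rewrite leNgt; apply/negP => e_lt; apply: not_lt.
have fac_gt0 : 0 < 1 + c%:R * q by rewrite addr_gt0 // mulr_gt0 // -(pmulr_lgt0 _ eq_gt0); lra.
apply: lt_trans (_ : (1 + c%:R * q) * e < _); last by rewrite ltr_pM2l.
lra.
Qed.

(** * Bounds on the equilibrium value *)

Section Nash.
Variables (R : realType) (N k ka T : nat) (alpha : R).
Variables (p : {ffun {set 'I_N} -> R}) (sigma : 'M[bool]_(N, T)).
Hypotheses (N_ge2 : (2 <= N)%N) (ka_ge1 : (1 <= ka)%N) (T_gt0 : (0 < T)%N).
Hypothesis nash : is_nash k ka alpha p sigma.

Let value : R := \sum_i total_age R (marginal R N p i) (row_of N sigma i) T.

Let scale_gt0 : 0 < T%:R^-1 * N%:R^-1 :> R.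
Proof. by rewrite mulr_gt0 // invr_gt0 ltr0n // ltnW. Qed.

Lemma nash_value_le p' : is_kdist k p' ->
  value <= \sum_i total_age R (marginal R N p' i) (row_of N sigma i) T.
Proof.
case: nash => pK _ best _ p'K; have := best _ p'K.
by rewrite !(payoffE R N k) // ler_pM2l.
Qed.

Definition window_block (c m : nat) (j : 'I_N) : 'M[bool]_(N, T) :=
  \matrix_(i, t) ((i == j) ==> window c m t).

Lemma window_block_feasible c m j : (c + m <= T)%N -> alpha * T%:R = m%:R ->
  feasible ka alpha (window_block c m j).
Proof.
move=> cm_T m_def; split.
  rewrite m_def ler_nat -sum_blocks (bigD1 j) //= big1 ?addn0 => [|i /negPf i_j].
    rewrite -[leqRHS](@blocks_window R c m (T - (c + m))) subnKC //.
    by apply: leq_sum => t _; rewrite row_ofE mxE eqxx.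
  by rewrite /blocks big1 // => t _; rewrite row_ofE mxE i_j.
move=> t; apply: leq_trans ka_ge1; rewrite -(cards1 j); apply: subset_leq_card.
by apply/subsetP => i; rewrite !inE mxE; case: (i == j).
Qed.

(** No window attack on a single user [j] beats the equilibrium. Summed over [j], every user is
    attacked exactly once and left alone [N - 1] times, and Jensen replaces the marginals by their
    mean [k / N]. *)
Lemma nash_value_ge c m : (c + m <= T)%N -> alpha * T%:R = m%:R ->
  total_age R (k%:R / N%:R) (window c m) T +
    (N%:R - 1) * total_age R (k%:R / N%:R) (fun=> true) T <= value.
Proof.
move=> cm_T m_def; have [pK _ _ best] := nash.
have N_gt0 : 0 < N%:R :> R by rewrite ltr0n ltnW.
pose x i : R := marginal R N p i.
have sum_x : \sum_i x i = #|'I_N|%:R * (k%:R / N%:R).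
  by rewrite (sum_marginal R N k) // card_ord; field; rewrite gt_eqF.
have x_le1 i : x i <= 1 by exact: marginal_le1 pK.
have q_ge0 : 0 <= k%:R / N%:R :> R by rewrite divr_ge0.
have q_le1 : k%:R / N%:R <= 1 :> R.
  rewrite ler_pdivrMr // mul1r -(sum_marginal R N k p pK).
  by rewrite (le_trans (ler_sum _ (fun i _ => x_le1 i))) // sumr_const card_ord.
have jensen r := jensen_total_age R _ x _ r T q_ge0 q_le1 x_le1 sum_x.
rewrite -(ler_pM2l N_gt0).
have : \sum_(j < N) \sum_i total_age R (x i) (row_of N (window_block c m j) i) T <=
    N%:R * value.
  rewrite mulr_natl -[X in _ *+ X]card_ord -sumr_const; apply: ler_sum => j _.
  have := best _ (window_block_feasible c m j cm_T m_def).
  by rewrite !(payoffE R N k) // ler_pM2l.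
apply: le_trans; rewrite exchange_big /=.
have split_i i : \sum_(j < N) total_age R (x i) (row_of N (window_block c m j) i) T =
    total_age R (x i) (window c m) T + (N%:R - 1) * total_age R (x i) (fun=> true) T.
  have rowE j s : (s < T)%N ->
      row_of N (window_block c m j) i s = (i == j) ==> window c m s.
    by move=> s_T; rewrite (row_ofE N _ i (Ordinal s_T)) mxE.
  rewrite (bigD1 i) //=; congr (_ + _).
    by apply: eq_total_age => s s_T; rewrite rowE // eqxx.
  rewrite (eq_bigr (fun=> total_age R (x i) (fun=> true) T)) => [|j /negPf j_i].
    rewrite sumr_const cardC1 card_ord -[LHS]mulr_natl -subn1 natrB //.
    exact: ltnW.
  by apply: eq_total_age => s s_T; rewrite rowE // eq_sym j_i.
under eq_bigr do rewrite split_i.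
rewrite big_split /= -mulr_sumr mulrDr mulrCA.
have := jensen (window c m); have := jensen (fun=> true).
rewrite card_ord => le1 le2; apply: lerD => //.
by rewrite ler_wpM2l // subr_ge0 ler1n ltnW.
Qed.

End Nash.

(** * Best responses of the base station *)

(** The right side is the decrease per slot obtained by tilting when [m = alpha T]. It factors as
    [l (n - K) / a] times [alpha / K - l / b], where [l / b] is the second-order cost;
    [l = alpha / (4 n)] keeps this cost below half of [alpha / K]. *)
Lemma tilt_gain (R : realType) (n K alpha q l a b : R) :
  1 <= K -> K < n -> 0 < alpha -> alpha < 1 ->
  q = K / n -> l = alpha / (4 * n) ->
  a = (1 - l) * q + l -> b = (1 - l) * q ->
  alpha * (l * (n - K) / (2 * K * a)) <=
    n / q - K / a - (n - K) / b + alpha * (q^-1 - a^-1).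
Proof.
move=> K_ge1 K_n al_gt0 al_lt1 qE lE aE bE.
have n_gt0 : 0 < n by lra.
have K_gt0 : 0 < K by lra.
have q_gt0 : 0 < q by rewrite qE divr_gt0.
have l_gt0 : 0 < l by rewrite lE divr_gt0 // mulr_gt0.
have l_half : l <= 1 / 2 by rewrite lE ler_pdivrMr ?mulr_gt0 //; lra.
have b_gt0 : 0 < b by rewrite bE mulr_gt0 // subr_gt0; lra.
have a_gt0 : 0 < a by rewrite aE -bE addr_gt0.
have l_b : l / b <= alpha / (2 * K).
  rewrite ler_pdivrMr // mulrAC ler_pdivlMr ?mulr_gt0 // bE qE.
  rewrite [leLHS](_ : _ = (alpha * K / n) * (1 / 2));
    last by rewrite lE; field; rewrite gt_eqF.
  rewrite [leRHS](_ : _ = (alpha * K / n) * (1 - l)); last by field; rewrite gt_eqF.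
  by apply: ler_wpM2l; [rewrite !(divr_ge0, mulr_ge0) // ltW | lra].
have -> : n / q - K / a - (n - K) / b + alpha * (q^-1 - a^-1) =
    l * (n - K) / a * (alpha / K - l / b).
  have l1 : 0 < 1 - l by lra.
  by rewrite aE bE qE; field; rewrite !gt_eqF // addr_gt0 ?mulr_gt0.
have -> : alpha * (l * (n - K) / (2 * K * a)) = l * (n - K) / a * (alpha / (2 * K)).
  by field; rewrite !gt_eqF.
apply: ler_wpM2l; first by rewrite !(divr_ge0, mulr_ge0) ?subr_ge0 // ltW.
have -> : alpha / K = 2 * (alpha / (2 * K)) by field; rewrite gt_eqF.
lra.
Qed.

(* The first alternative comes from uniform scheduling, when no user is blocked
   [m] times; the second from tilting towards a set containing the user that is. *)
Lemma best_response_le (R : realType) (N k T m : nat)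
    (sigma : 'M[bool]_(N, T)) (q l a b v : R) :
  (1 <= k)%N -> (k < N)%N -> 0 < l -> l < 1 ->
  (#|[set x : 'I_N * 'I_T | ~~ sigma x.1 x.2]| <= m)%N ->
  (forall p, is_kdist k p ->
     v <= \sum_i total_age R (marginal R N p i) (row_of N sigma i) T) ->
  q = k%:R / N%:R -> a = (1 - l) * q + l -> b = (1 - l) * q ->
  v <= N%:R * (T%:R / q) + m%:R * (q^-1 + (m%:R - 2) / 2) \/
  v <= T%:R * (k%:R / a + (N%:R - k%:R) / b) + m%:R / a + m%:R * (m%:R - 1) / 2.
Proof.
move=> k_ge1 k_N l_gt0 l_lt1; rewrite -sum_blocks => sum_b v_le qE aE bE.
have N_gt0 : 0 < N%:R :> R by rewrite ltr0n (leq_ltn_trans _ k_N).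
have k_gt0 : 0 < k%:R :> R by rewrite ltr0n.
have q_gt0 : 0 < q by rewrite qE divr_gt0.
have q_lt1 : q < 1 by rewrite qE ltr_pdivrMr // mul1r ltr_nat.
have b_gt0 : 0 < b by rewrite bE mulr_gt0 // subr_gt0.
have b_le1 : b <= 1 by rewrite bE mulr_ile1 ?subr_ge0 ?ltW // ltrBlDr ltrDl.
have a_gt0 : 0 < a by rewrite aE -bE addr_gt0.
have a_le1 : a <= 1.
  have : 0 <= (1 - l) * (1 - q) by rewrite mulr_ge0 // subr_ge0 ltW.
  by rewrite aE; lra.
pose n i := blocks (row_of N sigma i) T.
have n_le i : (n i <= m)%N.
  by apply: leq_trans sum_b; rewrite (bigD1 i) //= leq_addr.
have [/existsP[i0 /eqP n_i0]|/existsPn n_lt] := boolP [exists i, n i == m]; last first.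
  left; have uK := uniform_kdistP R N k (ltnW k_N).
  apply: le_trans (v_le _ uK) _.
  have le_i i : total_age R (marginal R N (uniform_kdist R N k) i) (row_of N sigma i) T <=
      T%:R / q + (n i)%:R * (q^-1 + (m%:R - 2) / 2).
    rewrite marginal_uniform ?(ltnW k_N) // -qE.
    apply: le_trans (total_age_le R q _ T q_gt0 (ltW q_lt1)) _; rewrite -/(n i).
    (* Strictness bounds [n i (n i - 1) / 2] by [n i (m - 2) / 2], which is linear in [n i], so that
       only the total budget matters after summation. *)
    have : (n i)%:R + 1 <= m%:R :> R.
      by rewrite natr1 ler_nat ltn_neqAle n_lt n_le.
    move=> le_m; have : (n i)%:R * ((n i)%:R + 1) <= (n i)%:R * m%:R :> R.
      by rewrite ler_wpM2l.
    lra.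
  apply: le_trans (ler_sum _ (fun i _ => le_i i)) _.
  rewrite big_split /= sumr_const card_ord -mulr_suml -natr_sum -[_ *+ N]mulr_natl lerD2l.
  rewrite ler_wpM2r ?ler_nat //.
  (* This makes the factor [q^-1 + (m - 2) / 2] nonnegative even for [m < 2]. *)
  have : 1 <= q^-1 by rewrite invf_ge1 // ltW.
  have : 0 <= m%:R :> R by exact: ler0n.
  lra.
right; have n0 i : i != i0 -> n i = 0%N.
  move=> i_i0; apply/eqP; rewrite -leqn0 -(leq_add2l m) addn0.
  apply: leq_trans sum_b; rewrite (bigD1 i0) //= -/(n i0) n_i0 leq_add2l.
  by rewrite (bigD1 i) //= leq_addr.
(* Such a set exists because otherwise the uniform marginal of [i0] would vanish, while it equals
   [q > 0]. *)
have [S0 i0_S0 /eqP cardS0] : exists2 S0 : {set 'I_N}, i0 \in S0 & #|S0| == k.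
  apply/exists_inP; apply: contraT => /exists_inPn no_S.
  have := marginal_uniform R N k i0 (ltnW k_N); rewrite -qE /marginal big1.
    by move=> q0; rewrite -q0 ltxx in q_gt0.
  by move=> S /no_S /negPf cardS; rewrite ffunE cardS.
have tK := tilted_kdistP R N k l S0 (ltnW k_N) (ltW l_gt0) (ltW l_lt1) cardS0.
apply: le_trans (v_le _ tK) _.
pose y i := if i \in S0 then a else b.
have le_i i : total_age R (marginal R N (tilted_kdist R N k l S0) i) (row_of N sigma i) T <=
    T%:R * (y i)^-1 + ((n i)%:R / y i + (n i)%:R * ((n i)%:R - 1) / 2).
  rewrite marginal_tilted ?(ltnW k_N) //.
  have -> : (1 - l) * (k%:R / N%:R) + l * (i \in S0)%:R = y i.
    by rewrite -qE /y; case: (i \in S0); rewrite ?mulr1 ?mulr0 ?addr0 ?aE ?bE.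
  rewrite addrA; apply: total_age_le; rewrite /y; by case: ifP.
apply: le_trans (ler_sum _ (fun i _ => le_i i)) _.
rewrite big_split /= -mulr_sumr -addrA; apply: lerD; last first.
  rewrite (bigD1 i0) //= big1 ?addr0; last by move=> i /n0 ->; rewrite !mul0r addr0.
  by rewrite n_i0 /y i0_S0.
rewrite ler_wpM2l // (bigID (mem S0)) /=.
rewrite (eq_bigr (fun=> a^-1)) => [|i iS0]; last by rewrite /y iS0.
rewrite sumr_const cardS0 [X in _ + X](eq_bigr (fun=> b^-1)) => [|i /negPf iS0]; last first.
  by rewrite /y iS0.
rewrite sumr_const (_ : #|_| = (N - k)%N); last first.
  rewrite -cardS0 -[X in (X - _)%N]card_ord -(cardC (mem S0)) addKn.
  by apply: eq_card => i; rewrite !inE.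
by rewrite -[_ *+ k]mulr_natl -[_ *+ (N - k)]mulr_natl natrB ?(ltnW k_N).
Qed.

(** * Contradiction over long horizons *)

Theorem theorem16 (R : realType) (N k ka : nat) (alpha : R) :
  (2 <= N)%N -> (1 <= k)%N -> (k < N)%N -> (1 <= ka)%N ->
  0 < alpha -> alpha < 1 ->
  exists T0 : nat, forall T : nat, (T0 <= T)%N ->
    (exists m : nat, alpha * T%:R = m%:R) ->
    ~ exists (p : {ffun {set 'I_N} -> R}) (sigma : 'M[bool]_(N, T)),
        is_nash k ka alpha p sigma.
Proof.
move=> N_ge2 k_ge1 k_N ka_ge1 al_gt0 al_lt1.
have N_gt0 : 0 < N%:R :> R by rewrite ltr0n ltnW.
have N_ge1 : 1 <= N%:R :> R by rewrite ler1n ltnW.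
have k_ge1R : 1 <= k%:R :> R by rewrite ler1n.
have k_gt0 : 0 < k%:R :> R by rewrite ltr0n.
have k_NR : k%:R < N%:R :> R by rewrite ltr_nat.
pose q : R := k%:R / N%:R.
have q_gt0 : 0 < q by rewrite divr_gt0.
have q_le1 : q <= 1 by rewrite ler_pdivrMr // mul1r ltW.
pose l := alpha / (4 * N%:R).
have l_gt0 : 0 < l by rewrite divr_gt0 ?mulr_gt0.
have l_lt1 : l < 1 by rewrite ltr_pdivrMr ?mulr_gt0 //; lra.
pose a := (1 - l) * q + l; pose b := (1 - l) * q.
have b_gt0 : 0 < b by rewrite mulr_gt0 // subr_gt0.
have a_gt0 : 0 < a by rewrite addr_gt0.
pose kappa := l * (N%:R - k%:R) / (2 * k%:R * a).
have kappa_gt0 : 0 < kappa.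
  apply: divr_gt0; last by rewrite !mulr_gt0.
  by rewrite mulr_gt0 // subr_gt0.
have gain : alpha * kappa <=
    N%:R / q - k%:R / a - (N%:R - k%:R) / b + alpha * (q^-1 - a^-1).
  exact: (@tilt_gain R N%:R k%:R alpha q l a b).
(* The errors in the lower bound will total less than [2 tau m]; this has to stay within [m / 2] in
   the first alternative and within [kappa m] in the second. *)
pose tau := Num.min (1 / 4) (kappa / 2).
have tau_gt0 : 0 < tau by rewrite lt_min divr_gt0 //= divr_gt0.
have tau_le4 : tau <= 1 / 4 by rewrite ge_min lexx.
have tau_kappa : 2 * tau <= kappa.
  have : tau <= kappa / 2 by rewrite ge_min lexx orbT.
  lra.
(* With this margin [c] the two window errors [m (1 - q)^c / q] add up to at most [tau m]. *)
have [c c_small] := exists_small_power R q (tau * q / 2) q_gt0 q_le1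
  (divr_gt0 (mulr_gt0 tau_gt0 q_gt0) (ltr0Sn _ _)).
pose C := N%:R * q^-1 ^+ 2.
(* The second entry ensures [C < tau m], where [C] is the constant loss of all [N] users; the third
   ensures [2 c < T - m], so the window fits with [c] slots on either side. *)
pose T0 := maxn 1 (maxn
  (Num.bound (C / (tau * alpha)))
  (Num.bound ((2 * c)%:R / (1 - alpha)))).
exists T0 => T; rewrite !geq_max => /and3P[T_gt0 T_C T_c] [m m_def] [p [sigma nash]].
have bound_le (x : R) : (Num.bound x <= T)%N -> 0 <= x -> x < T%:R.
  by move=> x_T /archi_boundP /lt_le_trans; apply; rewrite ler_nat.
have C_ge0 : 0 <= C by rewrite mulr_ge0 ?sqr_ge0.
have C_lt : C < tau * m%:R.
  rewrite -m_def mulrA mulrC -ltr_pdivrMr ?mulr_gt0 //.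
  by apply: bound_le; rewrite // divr_ge0 // ltW // mulr_gt0.
have c_lt : (2 * c)%:R < T%:R - m%:R :> R.
  have -> : T%:R - m%:R = T%:R * (1 - alpha) by rewrite -m_def; ring.
  rewrite -ltr_pdivrMr ?subr_gt0 //.
  by apply: bound_le; rewrite // divr_ge0 // subr_ge0 ltW.
have c_mT : (c + m + c <= T)%N.
  rewrite -(ler_nat R) addnAC addnn -mul2n natrD; lra.
have cm_T : (c + m <= T)%N by apply: leq_trans c_mT; rewrite leq_addr.
have m_ge0 : 0 <= m%:R :> R by exact: ler0n.
have := nash_value_ge R N k ka T alpha p sigma N_ge2 ka_ge1 T_gt0 nash c m cm_T m_def.
have := nash_value_le R N k ka T alpha p sigma N_ge2 T_gt0 nash.
set v := \sum_i _ => v_le v_ge.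
have window_ge : T%:R / q - q^-1 ^+ 2 + m%:R / q + m%:R * (m%:R - 1) / 2 - tau * m%:R <=
    total_age R q (window c m) T.
  have c_n : (c <= T - (c + m))%N by rewrite leq_subRL.
  have := total_age_window_ge R q c m (T - (c + m)) q_gt0 q_le1 c_n.
  rewrite subnKC // => le_total; apply: le_trans le_total; rewrite lerD2l lerN2.
  have : m%:R * (1 - q) ^+ c / q <= m%:R * (tau / 2).
    rewrite -mulrA ler_wpM2l // ler_pdivrMr //; lra.
  lra.
have unblocked_ge := total_age_unblocked_ge R q T q_gt0 q_le1.
have low : N%:R * (T%:R / q) - C + m%:R / q + m%:R * (m%:R - 1) / 2 - tau * m%:R <= v.
  have : (N%:R - 1) * (T%:R / q - q^-1 ^+ 2) <=
      (N%:R - 1) * total_age R q (fun=> true) T.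
    by rewrite ler_wpM2l // subr_ge0.
  rewrite -/q in v_ge; rewrite /C; lra.
have card_m : (#|[set x : 'I_N * 'I_T | ~~ sigma x.1 x.2]| <= m)%N.
  by have [_ [le_m _] _ _] := nash; rewrite m_def ler_nat in le_m.
have m_gt0 : 0 < m%:R :> R by rewrite -m_def mulr_gt0 // ltr0n.
have := best_response_le R N k T m sigma q l a b v k_ge1 k_N l_gt0 l_lt1 card_m v_le
  erefl erefl erefl.
(* In the first alternative the bounds differ by [m / 2], from [m (m - 1) / 2] against
   [m (m - 2) / 2], which exceeds [C + tau m]. *)
case=> high.
  have : tau * m%:R <= 1 / 4 * m%:R by rewrite ler_wpM2r.
  lra.
(* In the second the quadratic terms cancel, and the tilt gains at least [kappa m], again more than
   [C + tau m]. *)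
have : T%:R * (alpha * kappa) <=
    T%:R * (N%:R / q - k%:R / a - (N%:R - k%:R) / b + alpha * (q^-1 - a^-1)).
  by rewrite ler_wpM2l.
have : 2 * tau * m%:R <= kappa * m%:R by rewrite ler_wpM2r.
have -> : T%:R * (alpha * kappa) = kappa * m%:R by rewrite -m_def; ring.
have -> : T%:R * (N%:R / q - k%:R / a - (N%:R - k%:R) / b + alpha * (q^-1 - a^-1)) =
    N%:R * (T%:R / q) - T%:R * (k%:R / a + (N%:R - k%:R) / b) + (m%:R / q - m%:R / a).
  by rewrite -m_def; ring.
lra.
Qed.
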